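(* Assume that $X$ and $Y:=\operatorname{dom}F^*$ are compact, and that $B=I$ (so $\mathcal W=\mathcal Y$), $b=0$. In the AADMM algorithm (described in the context), if the total number of iterations $N$ is chosen, and the parameters are set to $$\alpha_t=\frac2{t+1},\quad\theta_t=\tau_t=\rho_t=\frac{\rho N}t,\quad\eta_t=\frac{2L_G+\chi\rho N\|K\|^2}t,$$ where $\rho$ is given by $\rho=\dfrac{D_Y}{\chi\|K\|D_X+(1-\chi)D_{X,K}}$, then $$G(x_N^{ag})+F(Kx_N^{ag})-f^*\le\frac{2L_GD_X^2}{N(N-1)}+\frac2{N-1}\big[\chi\|K\|D_XD_Y+(1-\chi)D_{X,K}D_Y\big].$$
   Context: $\mathcal W,\mathcal X,\mathcal Y$ are finite-dimensional vector spaces equipped with inner product $\langle\cdot,\cdot\rangle$, norm $\|\cdot\|$ and conjugate norm $\|\cdot\|_*$; $X\subseteq\mathcal X$ is a closed convex set; $G:X\to\mathbb R$ and $F:\mathcal W\to\mathbb R$ are finite-valued, convex and lower semicontinuous; $F^*(u)=\sup_{w}\langle u,w\rangle-F(w)$ is the convex conjugate of $F$ and $\operatorname{dom}F^*=\{u:F^*(u)<\infty\}$; $K:\mathcal X\to\mathcal Y$ and $B:\mathcal W\to\mathcal Y$ are bounded linear operators, $\|K\|$ is the operator norm; $b\in\mathcal Y$. $G$ is continuously differentiable and there is $L_G>0$ with $G(x_2)-G(x_1)-\langle\nabla G(x_1),x_2-x_1\rangle\le\frac{L_G}{2}\|x_2-x_1\|^2$ for all $x_1,x_2\in X$. Problem: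 minimize $G(x)+F(w)$ over $x\in X$, $w\in\mathcal W$ subject to $Bw-Kx=b$ (when $B=I,b=0$ this is $\min_{x\in X}G(x)+F(Kx)$). It is assumed that there is an optimal solution $(w^*,x^* )$ and $y^*\in\mathcal Y$ such that $(w^*,x^*,y^* )$ is a saddle point of $\min_{x\in X,w\in\mathcal W}\max_{y\in\mathcal Y}G(x)+F(w)-\langle y,Bw-Kx-b\rangle$. $f^*:=G(x^* )+F(w^* )$ is the optimal value. Constants: $D_S:=\sup_{s_1,s_2\in S}\|s_1-s_2\|$ for a compact set $S$; $D_{X,K}:=\sup_{u_1,u_2\in X}\|Ku_1-Ku_2\|$. AADMM algorithm. $\chi\in\{0,1\}$ is a binary constant; $\alpha_t,\theta_t,\tau_t,\rho_t,\eta_t$ are parameters. Choose $x_1\in X$, $w_1\in\mathcal W$ with $Bw_1=Kx_1+b$; set $x_1^{ag}=x_1$, $w_1^{ag}=w_1$, $y_1^{ag}=y_1=0$. For $t=1,\dots,N-1$: $$\begin{aligned}x_t^{md}&=(1-\alpha_t)x_t^{ag}+\alpha_tx_t,\\ x_{t+1}&=\operatorname*{argmin}_{x\in X}\ \langle\nabla G(x_t^{md}),x\rangle-\chi\theta_t\langle Bw_t-Kx_t-b,Kx\rangle+\tfrac{(1-\chi)\theta_t}2\|Bw_t-Kx-b\|^2+\langle y_t,Kx\rangle+\tfrac{\eta_t}2\|x-x_t\|^2,\\ x_{t+1}^{ag}&=(1-\alpha_t)x_t^{ag}+\alpha_tx_{t+1},\\ w_{t+1}&=\operatorname*{argmin}_{w\in\mathcal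 W}\ F(w)-\langle y_t,Bw\rangle+\tfrac{\tau_t}2\|Bw-Kx_{t+1}-b\|^2,\\ w_{t+1}^{ag}&=(1-\alpha_t)w_t^{ag}+\alpha_tw_{t+1},\\ y_{t+1}&=y_t-\rho_t(Bw_{t+1}-Kx_{t+1}-b),\\ y_{t+1}^{ag}&=(1-\alpha_t)y_t^{ag}+\alpha_ty_{t+1}.\end{aligned}$$
   Formalization: The formal theorem adds the assumption that the initial multiplier y_1 = 0 lies in Y = dom F*; without it the bound fails (X=[-1,1], K=I, G=0, L_G=1, F(w)=10w+|w|, χ=1, N=2, x_1=w_1=1 gives 20 on the left and 12 on the right). *)

(* Defs.v *)
From HB Require Import structures.
From mathcomp Require Import all_boot all_order all_algebra.
From mathcomp Require Import sesquilinear.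
From mathcomp Require Import all_classical all_reals all_analysis.

Set Implicit Arguments.
Unset Strict Implicit.
Unset Printing Implicit Defensive.

Import Order.TTheory GRing.Theory Num.Theory.
Import numFieldNormedType.Exports.

Local Open Scope classical_set_scope.
Local Open Scope ring_scope.

#[short(type="normedVectType")]
HB.structure Definition NormedVector (R : numFieldType) :=
  {V of NormedModule R V & Vector R V}.

(* Over a real field, a form hermitian for the identity is symmetric. *)
Notation "{ 'inner' V }" := {dot V for idfun}
  (at level 0, format "{ 'inner'  V }") : type_scope.

(* The norm is the one induced by the inner product, hence equal to its
   conjugate norm. *)
Definition induces_norm (R : realType) (V : normedVectType R)
    (ip : {inner V}) : Prop :=
  forall v : V, ip v v = `|v| ^+ 2.

Section ConvexAnalysis.
Context {R : realType}.
Implicit Types E V : normedVectType R.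
Local Open Scope ereal_scope.

Definition fconj V (ip : {inner V}) (F : V -> R) (u : V) : \bar R :=
  ereal_sup [set (ip u w - F w)%:E | w in [set: V]].

Definition dom_fconj V (ip : {inner V}) (F : V -> R) : set V :=
  [set u | fconj ip F u < +oo].

Local Open Scope ring_scope.

Definition diam V (S : set V) : R :=
  sup [set `|s.1 - s.2| | s in S `*` S].

Definition diam_under E V (K : E -> V) (S : set E) : R :=
  sup [set `|K u.1 - K u.2| | u in S `*` S].

Definition opnorm E V (K : E -> V) : R :=
  sup [set `|K x| | x in [set x : E | `|x| <= 1]].

Definition is_argmin (T : Type) (D : set T) (f : T -> R) (a : T) : Prop :=
  D a /\ forall z, D z -> f a <= f z.

(* Fréchet differentiability relative to X, which may have empty interior;
   only the values of G and gradG on X matter. *)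
Definition is_gradient_on E (ip : {inner E}) (X : set E) (G : E -> R)
    (gradG : E -> E) : Prop :=
  forall x, X x -> forall e : R, 0 < e ->
    \forall z \near within X (nbhs x),
      `|G z - G x - ip (gradG x) (z - x)| <= e * `|z - x|.

Definition C1_on E (ip : {inner E}) (X : set E) (G : E -> R)
    (gradG : E -> E) : Prop :=
  is_gradient_on ip X G gradG /\ {within X, continuous gradG}.

End ConvexAnalysis.

Section Problem.
Context {R : realType} (E W V : normedVectType R).
Context (ipE : {inner E}) (ipV : {inner V}).
Context (X : set E) (G : E -> R) (F : W -> R).
Context (B : W -> V) (K : E -> V) (b : V).

Definition is_optimal (w : W) (x : E) : Prop :=
  [/\ X x, B w - K x = b &
      forall w' x', X x' -> B w' - K x' = b -> G x + F w <= G x' + F w'].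

Definition lagrangian (w : W) (x : E) (y : V) : R :=
  G x + F w - ipV y (B w - K x - b).

Definition is_saddle_point (w : W) (x : E) (y : V) : Prop :=
  [/\ X x,
      forall y', lagrangian w x y' <= lagrangian w x y &
      forall w' x', X x' -> lagrangian w x y <= lagrangian w' x' y].

(* chi = 1 linearizes the penalty term in the x-step, chi = 0 keeps it exact.
   The entries of the sequences at index 0 and beyond N are unconstrained. *)
Record is_aadmm (gradG : E -> E) (chi : bool)
    (alpha theta tau rho eta : nat -> R) (N : nat)
    (x xmd xag : nat -> E) (w wag : nat -> W) (y yag : nat -> V) : Prop := {
  aadmm_x1 : X (x 1%N);
  aadmm_w1 : B (w 1%N) = K (x 1%N) + b;
  aadmm_xag1 : xag 1%N = x 1%N;
  aadmm_wag1 : wag 1%N = w 1%N;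
  aadmm_y1 : y 1%N = 0;
  aadmm_yag1 : yag 1%N = 0;
  aadmm_xmd : forall t, (1 <= t < N)%N ->
    xmd t = (1 - alpha t) *: xag t + alpha t *: x t;
  aadmm_x : forall t, (1 <= t < N)%N ->
    is_argmin X (fun z =>
        ipE (gradG (xmd t)) z
        - chi%:R * theta t * ipV (B (w t) - K (x t) - b) (K z)
        + (1 - chi%:R) * theta t / 2 * `|B (w t) - K z - b| ^+ 2
        + ipV (y t) (K z)
        + eta t / 2 * `|z - x t| ^+ 2)
      (x t.+1);
  aadmm_xag : forall t, (1 <= t < N)%N ->
    xag t.+1 = (1 - alpha t) *: xag t + alpha t *: x t.+1;
  aadmm_w : forall t, (1 <= t < N)%N ->
    is_argmin [set: W] (fun z =>
        F z - ipV (y t) (B z)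
        + tau t / 2 * `|B z - K (x t.+1) - b| ^+ 2)
      (w t.+1);
  aadmm_wag : forall t, (1 <= t < N)%N ->
    wag t.+1 = (1 - alpha t) *: wag t + alpha t *: w t.+1;
  aadmm_y : forall t, (1 <= t < N)%N ->
    y t.+1 = y t - rho t *: (B (w t.+1) - K (x t.+1) - b);
  aadmm_yag : forall t, (1 <= t < N)%N ->
    yag t.+1 = (1 - alpha t) *: yag t + alpha t *: y t.+1
}.

End Problem.

(* Main.v *)
Require Import Defs.
From HB Require Import structures.
From mathcomp Require Import all_boot all_order all_algebra.
From mathcomp Require Import sesquilinear.
From mathcomp Require Import all_classical all_reals all_analysis.
From mathcomp Require Import zify ring lra.

(** The proof is a Lyapunov argument. Fix a feasible point z (in the end the
    optimal one) and a multiplier u, and measure the aggregated iterates by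
    [Phi t = G (xag t) - G z + F (wag t) - F (K z) - <u, wag t - K (xag t)>].
    Convexity and smoothness of G along the aggregation (accelerated_step),
    convexity of F, and the fact that y_{t+1} is a subgradient of F at w_{t+1}
    (multiplier_subgradient) give
    [Phi (t+1) <= (1 - 2/(t+1)) Phi t + (2/(t+1)) A t]
    for an explicit A t. The optimality condition of the x-update, together
    with the four-point identity for inner products, turns A t into differences
    of squared distances; as t theta_t and t eta_t do not depend on t, these
    differences telescope after multiplication by t: [t A t <= P t - P (t+1)].
    The weights t are also those for which the recursion for Phi telescopes,
    whence N(N-1)/2 Phi N <= P 1 - P N (potential_descent, gap_bound).

    Only the multiplier distances |y_t - u|^2 carry weights that grow with t;
    they are absorbed because every y_t and u lie in the compact set dom F^*,
    whose diameter bounds those distances. To pass from Phi to the objective,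
    u is taken as a subgradient of F at K (xag N): then
    F (wag N) - <u, wag N - K (xag N)> >= F (K (xag N)). Subgradients exist by
    a finite-dimensional Hahn-Banach argument (exists_subgradient). The value
    of rho balances the primal and the dual part of P 1 - P N.

    When the denominator of rho vanishes, the multipliers never move and the
    argument above breaks down, but then K is constant on X and the method is
    accelerated gradient descent on G (const_gap_bound). *)

Set Implicit Arguments.
Unset Strict Implicit.
Unset Printing Implicit Defensive.

Import Order.TTheory GRing.Theory Num.Theory.
Import numFieldNormedType.Exports.

Local Open Scope classical_set_scope.
Local Open Scope ring_scope.

(** * Inner products *)

Section InnerProduct.
Context {R : realType} {V : normedVectType R} (ip : {inner V}).

Lemma innerC (u v : V) : ip u v = ip v u.
Proof. by rewrite hermC mul1r. Qed.

Lemma innerDl (u v z : V) : ip (u + v) z = ip u z + ip v z.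
Proof. exact: linearDl. Qed.

Lemma innerDr (u v z : V) : ip z (u + v) = ip z u + ip z v.
Proof. exact: linearDr. Qed.

Lemma innerNl (u z : V) : ip (- u) z = - ip u z.
Proof. exact: linearNl. Qed.

Lemma innerNr (u z : V) : ip z (- u) = - ip z u.
Proof. exact: linearNr. Qed.

Lemma innerZl a (u v : V) : ip (a *: u) v = a * ip u v.
Proof. exact: linearZl_LR. Qed.

Lemma innerZr a (u v : V) : ip u (a *: v) = a * ip u v.
Proof. exact: linearZr_LR. Qed.

Lemma inner0l (u : V) : ip 0 u = 0. Proof. exact: linear0l. Qed.

Lemma inner0r (u : V) : ip u 0 = 0. Proof. exact: linear0r. Qed.

Definition innerE := (innerDl, innerDr, innerNl, innerNr, innerZl, innerZr,
  inner0l, inner0r).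

Context (ip_norm : induces_norm ip).

Lemma normD_sqr (u v : V) :
  `|u + v| ^+ 2 = `|u| ^+ 2 + 2 * ip u v + `|v| ^+ 2.
Proof. rewrite -!ip_norm !innerE (innerC v u); ring. Qed.

(** The mechanism behind the telescoping sums: an inner product of differences
    is traded for squared distances. The three-point identities are the cases
    where two of the points coincide. *)
Lemma four_point (a b c d : V) :
  2 * ip (a - b) (c - d) =
    `|a - d| ^+ 2 - `|b - d| ^+ 2 + `|b - c| ^+ 2 - `|a - c| ^+ 2.
Proof.
rewrite -!ip_norm !innerE.
rewrite (innerC d a) (innerC d b) (innerC c b) (innerC c a); ring.
Qed.

End InnerProduct.

(** * Convexity along segments *)

Section Convexity.
Context {R : realType} {E : lmodType R}.

Lemma convex_setP (X : set E) x y s : convex_set X -> X x -> X y ->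
  0 <= s <= 1 -> X ((1 - s) *: x + s *: y).
Proof.
move=> cX Xx Xy /andP[s0 s1].
have s01 : 0 <= s <= 1 by rewrite s0.
have := cX y x (@Itv01 R s s0 s1) (mem_set Xy) (mem_set Xx).
by rewrite inE addrC.
Qed.

Lemma convex_functionP (X : set E) (f : E -> R) x y s :
  convex_function X f -> X x -> X y -> 0 <= s <= 1 ->
  f ((1 - s) *: x + s *: y) <= (1 - s) * f x + s * f y.
Proof.
move=> cf Xx Xy /andP[s0 s1].
have := cf (@Itv01 R s s0 s1) y x (mem_set Xy) (mem_set Xx).
by rewrite addrC [leRHS]addrC.
Qed.

Lemma segmentE (x y : E) (s : R) : (1 - s) *: x + s *: y = x + s *: (y - x).
Proof. by rewrite scalerBl scale1r scalerBr addrAC addrA. Qed.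

End Convexity.

(** First-order optimality conditions without differentiation: the increment of
    a convex-plus-quadratic objective along a segment is at most
    [s * a + s ^+ 2 * c], so minimality forces the slope [a] to be
    nonnegative. *)
Lemma slope_ge0 (R : realType) (a c : R) :
  (forall s, 0 < s <= 1 -> 0 <= s * a + s ^+ 2 * c) -> 0 <= a.
Proof.
move=> H; rewrite leNgt; apply/negP => a0.
(* Small enough that |s c| <= - a / 2. *)
pose s := Num.min 1 (- a / (2 * (`|c| + 1))).
have c0 : 0 <= `|c| by [].
have k0 : 0 < 2 * (`|c| + 1) by lra.
have s0 : 0 < s by rewrite lt_min ltr01 /= divr_gt0 // oppr_gt0.
have s1 : s <= 1 by rewrite ge_min lexx.
have sk : s * (2 * (`|c| + 1)) <= - a.
  by rewrite -ler_pdivlMr // ge_min lexx orbT.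
have := H s; rewrite s0 s1 => /(_ isT).
rewrite expr2 -mulrA -mulrDr pmulr_rge0 //.
have : s * c <= s * `|c| by rewrite ler_wpM2l ?ler_norm // ltW.
nra.
Qed.

(** * Diameters and the operator norm as actual bounds *)

Lemma le_diam (R : realType) (V : normedVectType R) (S : set V) a b :
  compact S -> S a -> S b -> `|a - b| <= diam S.
Proof.
move=> /compact_bounded/pinfty_ex_gt0[M _ SM] Sa Sb.
apply: ub_le_sup; last by exists (a, b).
exists (M + M) => _ [[u v] /= [Su Sv] <-].
by rewrite (le_trans (ler_normB _ _))// lerD//; exact: SM.
Qed.

Section Bounds.
Context {R : realType} {E V : normedVectType R}.

Lemma le_opnorm (K : {linear E -> V}) x : bounded_near K (nbhs (0 : E)) ->
  `|K x| <= opnorm K * `|x|.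
Proof.
move=> /linear_boundedP/pinfty_ex_gt0[M M0 KM].
have [->|x0] := eqVneq x 0; first by rewrite raddf0 !normr0 mulr0.
have nx : 0 < `|x| by rewrite normr_gt0.
rewrite -ler_pdivrMr//; apply: ub_le_sup.
  exists M => _ [z /= z1 <-]; rewrite (le_trans (KM z))//.
  by rewrite ler_piMr// ltW.
exists (`|x|^-1 *: x).
  by rewrite /= normrZ normfV normr_id mulVf// gt_eqF.
by rewrite linearZ normrZ normfV normr_id mulrC.
Qed.

Lemma opnorm_ge0 (K : {linear E -> V}) : bounded_near K (nbhs (0 : E)) ->
  0 <= opnorm K.
Proof.
move=> /linear_boundedP/pinfty_ex_gt0[M M0 KM].
apply: ub_le_sup; last by exists 0; rewrite /= ?linear0 normr0.
exists M => _ [z /= z1 <-]; rewrite (le_trans (KM z))//.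
by rewrite ler_piMr// ltW.
Qed.

Lemma le_diam_under (K : {linear E -> V}) (S : set E) a b :
  bounded_near K (nbhs (0 : E)) -> compact S -> S a -> S b ->
  `|K a - K b| <= diam_under K S.
Proof.
move=> Kb cS Sa Sb; apply: ub_le_sup; last by exists (a, b).
exists (opnorm K * diam S) => _ [[u v] /= [Su Sv] <-].
rewrite -linearB (le_trans (le_opnorm _ Kb))//.
by rewrite ler_wpM2l ?opnorm_ge0//; exact: le_diam.
Qed.

End Bounds.

(** * The gradient inequality *)

Section Gradient.
Context {R : realType} {E : normedVectType R} (ip : {inner E}).

(** As [X] may have empty interior, the usual limit of difference quotients is
    taken only along the segment from [x] to [z], which stays in [X]. If the
    inequality failed by [delta], the error [e * s * |z - x| <= s * delta / 2]
    of the first-order expansion would be too small to match convexity at a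
    point of parameter [s] near [x]. *)
Lemma gradient_inequality (X : set E) (G : E -> R) (gradG : E -> E) x z :
  convex_set X -> convex_function X G -> is_gradient_on ip X G gradG ->
  X x -> X z -> G x + ip (gradG x) (z - x) <= G z.
Proof.
move=> cX cG dG Xx Xz; rewrite leNgt; apply/negP => lt_z.
set d := z - x in lt_z *.
pose delta := G x + ip (gradG x) d - G z.
have delta0 : 0 < delta by rewrite subr_gt0.
have k0 : 0 < 2 * (`|d| + 1) by have := normr_ge0 d; lra.
pose e := delta / (2 * (`|d| + 1)).
have e0 : 0 < e by rewrite divr_gt0.
have ed : e * `|d| <= delta / 2.
  have -> : delta / 2 = e * (`|d| + 1).
    by rewrite /e; field; have := normr_ge0 d; lra.
  by rewrite ler_wpM2l ?(ltW e0)// lerDl.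
have := dG _ Xx _ e0; rewrite /prop_near1 /within /= => /nbhs_normP[r /= r0 Hr].
pose s := Num.min 1 (r / (2 * (`|d| + 1))).
have s0 : 0 < s by rewrite lt_min ltr01 /= divr_gt0.
have s1 : s <= 1 by rewrite ge_min lexx.
have s01 : 0 <= s <= 1 by rewrite ltW.
have sd : s * `|d| < r.
  have : s * (2 * (`|d| + 1)) <= r by rewrite -ler_pdivlMr // ge_min lexx orbT.
  have := normr_ge0 d; nra.
have Xs : X (x + s *: d) by rewrite -segmentE; exact: convex_setP.
have := Hr (x + s *: d); rewrite /ball_ /= opprD addNKr normrN normrZ gtr0_norm//.
move=> /(_ sd Xs); rewrite [x + _]addrC addrK innerZr normrZ gtr0_norm// => Hs.
have Gs := convex_functionP cG Xx Xz s01; rewrite segmentE -/d in Gs.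
rewrite [s *: d + x]addrC in Hs; have Hl := lerNnormlW Hs.
have sed : s * (e * `|d|) <= s * (delta / 2) by rewrite ler_wpM2l ?(ltW s0).
have sdelta : 0 < s * delta by rewrite mulr_gt0.
have : s * delta = s * G x + s * ip (gradG x) d - s * G z by rewrite /delta; ring.
lra.
Qed.

End Gradient.

(** * Existence of subgradients *)

Section Subgradient.
Context {R : realType} {V : normedVectType R} (ip : {inner V}) (F : V -> R).

Definition is_subgradient (w u : V) := forall z, F w + ip u (z - w) <= F z.

(** At a subgradient [u] the supremum defining the conjugate is attained, at
    [w]. *)
Lemma subgradient_dom_fconj w u : is_subgradient w u -> dom_fconj ip F u.
Proof.
move=> wu; apply: (@le_lt_trans _ _ ((ip u w - F w)%:E)); last exact: ltry.
apply: ge_ereal_sup => _ [z _ <-]; rewrite lee_fin.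
by have := wu z; rewrite !innerE; lra.
Qed.

Context (F_convex : convex_function [set: V] F).

(** The one-dimensional step of the Hahn-Banach theorem. The value [c] of the
    extended functional on [q] must lie above all slopes [lower] on the side
    of [- q] and below all slopes on the side of [q]; convexity of [F] makes
    these two families compatible. Orthogonality of [q] to [U] allows the
    representing vector to be corrected along [q] without changing the
    functional on [U]. *)
Lemma subgradient_extend (w0 u q : V) (U : {vspace V}) : 0 < ip q q ->
  (forall v, v \in U -> ip q v = 0) ->
  (forall v, v \in U -> F w0 + ip u v <= F (w0 + v)) ->
  exists u', forall v, v \in (U + <[q]>)%VS -> F w0 + ip u' v <= F (w0 + v).
Proof.
move=> q0 qU uU.
pose lower (p : V * R) := (F w0 + ip u p.1 - F (w0 + p.1 - p.2 *: q)) / p.2.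
pose D := [set p : V * R | p.1 \in U /\ 0 < p.2].
have cross (v v' : V) (s t : R) : v \in U -> v' \in U -> 0 < s -> 0 < t ->
    lower (v, s) <= (F (w0 + v' + t *: q) - F w0 - ip u v') / t.
  move=> vU v'U s0 t0; rewrite /lower /=.
  rewrite ler_pdivrMr// mulrAC ler_pdivlMr//.
  have st0 : 0 < s + t by rewrite addr_gt0.
  (* The weight for which the contributions along q cancel. *)
  have [l lE] : exists l, l = s / (s + t) by exists (s / (s + t)).
  have l01 : 0 <= l <= 1.
    apply/andP; split; first by rewrite lE divr_ge0 ?ltW.
    by rewrite lE ler_pdivrMr// mul1r lerDl ltW.
  have l1 : 1 - l = t / (s + t) by rewrite lE; field; rewrite gt_eqF.
  have := convex_functionP (x := w0 + v - s *: q) (y := w0 + v' + t *: q)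
    F_convex I I l01.
  pose m := (1 - l) *: v + l *: v'.
  have -> : (1 - l) *: (w0 + v - s *: q) + l *: (w0 + v' + t *: q) = w0 + m.
    rewrite -[- (s *: q)]scaleNr !scalerDr !scalerA addrACA (addrACA (_ *: w0)).
    rewrite -!scalerDl subrK scale1r l1 lE.
    have -> : t / (s + t) * - s + s / (s + t) * t = 0 by field; rewrite gt_eqF.
    by rewrite scale0r addr0 /m l1 lE.
  have mU : m \in U by rewrite memvD // memvZ.
  move/(le_trans (uU _ mU)); rewrite !innerE l1 lE -(ler_pM2r st0).
  set a := F (_ - _); set b := F (_ + _ *: q).
  have -> : (F w0 + (t / (s + t) * ip u v + s / (s + t) * ip u v')) * (s + t) =
      (s + t) * F w0 + t * ip u v + s * ip u v' by field; rewrite gt_eqF.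
  have -> : (t / (s + t) * a + s / (s + t) * b) * (s + t) = t * a + s * b.
    by field; rewrite gt_eqF.
  lra.
pose c := sup (lower @` D).
have lower_c v s : v \in U -> 0 < s -> lower (v, s) <= c.
  move=> vU s0; apply: ub_le_sup; last by exists (v, s).
  exists ((F (w0 + 0 + 1 *: q) - F w0 - ip u 0) / 1).
  move=> _ [[v' s'] /= [v'U s'0] <-].
  by apply: cross => //; exact: mem0v.
have upper_c v t : v \in U -> 0 < t ->
    c <= (F (w0 + v + t *: q) - F w0 - ip u v) / t.
  move=> vU t0; apply: ge_sup.
    by exists (lower (0, 1)), (0, 1) => //; split=> //=; exact: mem0v.
  by move=> _ [[v' s'] /= [v'U s'0] <-]; exact: cross.
exists (u + ((c - ip u q) / ip q q) *: q) => _ /memv_addP[v vU [_ /vlineP[a ->] ->]].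
have -> : ip (u + (c - ip u q) / ip q q *: q) (v + a *: q) = ip u v + a * c.
  by rewrite !innerE (qU _ vU); field; rewrite gt_eqF.
rewrite !addrA; case: (ltgtP a 0) => [a0|a0|->].
- have na0 : 0 < - a by rewrite oppr_gt0.
  have := lower_c _ _ vU na0; rewrite /lower /= scaleNr opprK ler_pdivrMr//; lra.
- have := upper_c _ _ vU a0; rewrite ler_pdivlMr//; lra.
- by rewrite scale0r mul0r !addr0; exact: uU.
Qed.

(** Pairing with a basis of [U] is a linear map into a space of dimension
    [\dim U], hence it has a nonzero kernel. *)
Lemma exists_orthogonal (U : {vspace V}) : (\dim U < \dim {:V})%N ->
  exists2 q, q != 0 & forall v, v \in U -> ip q v = 0.
Proof.
move=> dimU.
pose f (q : V) : 'rV[R]_(\dim U) := \row_i ip q (vbasis U)`_i.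
have f_lin : linear f.
  by move=> a u v; apply/rowP => i; rewrite !mxE !innerE.
pose fL : {linear V -> 'rV[R]_(\dim U)} :=
  HB.pack f (GRing.isLinear.Build _ _ _ _ f f_lin).
pose K := lker (linfun fL).
have K0 : K != 0%VS.
  rewrite -dimv_eq0 -lt0n.
  have := limg_ker_dim (linfun fL) fullv; rewrite capfv -/K.
  have := dimvS (subvf (limg (linfun fL))); rewrite dimvf /dim /= mul1n.
  lia.
exists (vpick K); first by rewrite vpick0.
move=> v vU; have := memv_pick K; rewrite memv_ker lfunE => /eqP fq0.
rewrite (coord_vbasis vU) linear_sumr big1 // => i _.
apply: etrans (innerZr _ _ _ _) _; have := congr1 (fun r : 'rV_ _ => r 0 i) fq0.
by rewrite !mxE => ->; rewrite mulr0.
Qed.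

Lemma exists_subgradient w0 : exists u, is_subgradient w0 u.
Proof.
suff [u Hu] : exists u, forall v, v \in {:V}%VS -> F w0 + ip u v <= F (w0 + v).
  by exists u => z; rewrite (le_trans (Hu _ (memvf _)))// subrKC.
(* Dimensions are added one at a time, starting from the zero subspace. *)
suff H k : (k <= \dim {:V})%N -> exists U : {vspace V}, \dim U = k /\
    exists u, forall v, v \in U -> F w0 + ip u v <= F (w0 + v).
  have [U [dU]] := H _ (leqnn _).
  suff -> : U = fullv by [].
  by apply/eqP; rewrite eqEdim subvf dU leqnn.
elim: k => [_|k IH kd].
  exists 0%VS; split; first exact: dimv0.
  by exists 0 => v; rewrite memv0 => /eqP ->; rewrite inner0l !addr0.
have [U [dU [u Hu]]] := IH (ltnW kd).
have [q q0 qU] : exists2 q, q != 0 & forall v, v \in U -> ip q v = 0.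
  by apply: exists_orthogonal; rewrite dU.
have qq : 0 < ip q q by exact: neq0_dnorm_gt0.
exists (U + <[q]>)%VS; split; last exact: (subgradient_extend qq qU Hu).
rewrite dimv_disjoint_sum ?dU ?dim_vline ?q0 ?addn1//.
apply/eqP; rewrite -subv0; apply/subvP => v; rewrite memv_cap => /andP[vU].
move=> /vlineP[a va]; have := qU _ vU; rewrite va innerZr => /eqP.
by rewrite mulf_eq0 (gt_eqF qq) orbF => /eqP ->; rewrite scale0r mem0v.
Qed.

End Subgradient.

(** * One step of the method *)

Section Steps.
Context {R : realType}.

(** With [tau] equal to the dual step size, the vector [y - tau *: (w - c)] is
    the updated multiplier: this is why the multipliers are subgradients of
    [F]. *)
Lemma prox_subgradient (V : normedVectType R) (ip : {inner V}) (F : V -> R)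
    (y c w : V) (tau : R) :
  induces_norm ip -> convex_function [set: V] F ->
  is_argmin [set: V] (fun z => F z - ip y z + tau / 2 * `|z - c| ^+ 2) w ->
  is_subgradient ip F w (y - tau *: (w - c)).
Proof.
move=> ip_norm cF [_ w_min] z; set d := z - w.
suff : 0 <= F z - F w - ip y d + tau * ip (w - c) d by rewrite !innerE; lra.
apply: (slope_ge0 (c := tau / 2 * `|d| ^+ 2)) => s /andP[s0 s1].
have s01 : 0 <= s <= 1 by rewrite ltW.
have := w_min (w + s *: d) I.
have := convex_functionP (x := w) (y := z) cF I I s01; rewrite segmentE -/d.
rewrite [w + _ - c]addrAC (normD_sqr ip_norm (w - c)).
rewrite normrZ exprMn real_normK ?num_real// !innerE; lra.
Qed.

(** The variational inequality of the [x]-update. Both variants of the update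
    are covered at once by [c]: the penalty gradient is evaluated at the old
    point [x] when [c = 1] and at the new point [x'] when [c = 0]. *)
Lemma x_step_inequality (E V : normedVectType R) (ipE : {inner E})
    (ipV : {inner V}) (X : set E) (K : {linear E -> V}) (g : E) (y w : V)
    (c theta eta : R) (x x' z : E) :
  induces_norm ipE -> induces_norm ipV -> convex_set X ->
  is_argmin X (fun z => ipE g z - c * theta * ipV (w - K x) (K z)
    + (1 - c) * theta / 2 * `|w - K z| ^+ 2 + ipV y (K z)
    + eta / 2 * `|z - x| ^+ 2) x' ->
  X z ->
  ipE g (x' - z) <=
    ipV (y - theta *: (w - (c *: K x + (1 - c) *: K x'))) (K z - K x')
    + eta * ipE (x' - x) (z - x').
Proof.
move=> ipE_norm ipV_norm cX [Xx' x'_min] Xz; set d := z - x'.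
have Kd : K z - K x' = K d by rewrite linearB.
rewrite -[x' - z]opprB -/d Kd -subr_ge0.
apply: (slope_ge0 (c := (1 - c) * theta / 2 * `|K d| ^+ 2 + eta / 2 * `|d| ^+ 2)).
move=> s /andP[s0 s1].
have s01 : 0 <= s <= 1 by rewrite ltW.
have Xs : X (x' + s *: d) by rewrite -segmentE; exact: convex_setP.
have Ks : K (x' + s *: d) = K x' + s *: K d by rewrite linearD linearZ.
have := x'_min _ Xs; rewrite Ks [x' + _ - x]addrAC.
have -> : w - (K x' + s *: K d) = (w - K x') + (- s) *: K d.
  by rewrite opprD addrA scaleNr.
rewrite (normD_sqr ipE_norm (x' - x)).
rewrite (normD_sqr ipV_norm (w - K x')) !normrZ !exprMn !real_normK ?num_real//.
rewrite !innerE; lra.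
Qed.

(** The aggregate moves from the middle point by [a *: (x' - x)], so the
    smoothness error is of order [a ^+ 2]; the middle point is compared with
    both [xag] and [z] by the gradient inequality, with weights [1 - a] and
    [a]. *)
Lemma accelerated_step (E : normedVectType R) (ip : {inner E}) (X : set E)
    (G : E -> R) (gradG : E -> E) (LG a : R) (xag x x' z : E) :
  convex_set X -> convex_function X G -> is_gradient_on ip X G gradG ->
  (forall x1 x2, X x1 -> X x2 ->
     G x2 - G x1 - ip (gradG x1) (x2 - x1) <= LG / 2 * `|x2 - x1| ^+ 2) ->
  X xag -> X x -> X x' -> X z -> 0 <= a <= 1 ->
  G ((1 - a) *: xag + a *: x') - G z <=
    (1 - a) * (G xag - G z)
    + a * (ip (gradG ((1 - a) *: xag + a *: x)) (x' - z)
           + LG * a / 2 * `|x' - x| ^+ 2).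
Proof.
move=> cX cG dG smooth Xag Xx Xx' Xz a01; have /andP[a0 a1] := a01.
set md := _ + a *: x; set g := gradG md.
have Xmd : X md by exact: convex_setP.
have Xag' : X ((1 - a) *: xag + a *: x') by exact: convex_setP.
have := smooth _ _ Xmd Xag'.
have -> : (1 - a) *: xag + a *: x' - md = a *: (x' - x).
  by rewrite /md opprD addrACA subrr add0r scalerBr.
rewrite normrZ exprMn real_normK ?num_real// -/g.
have gmd : ip g md = (1 - a) * ip g xag + a * ip g x by rewrite /md !innerE.
have a1' : 0 <= 1 - a by rewrite subr_ge0.
have := ler_wpM2l a1' (gradient_inequality cX cG dG Xmd Xag).
have := ler_wpM2l a0 (gradient_inequality cX cG dG Xmd Xz).
rewrite -/g; clearbody g md; rewrite !innerE gmd; lra.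
Qed.

(** The left side collects the coupling terms of one iteration. Since the
    penalty parameter and the dual step size are both [theta], the terms in
    [y] cancel and only squared distances remain, up to a term in the
    multipliers that dual_step bounds. *)
Lemma primal_step (V : normedVectType R) (ip : {inner V})
    (y yy w w' kx kx' kz : V) (c theta : R) : induces_norm ip ->
  let y' := y - theta *: (w' - kx') in
  ip (y - theta *: (w - (c *: kx + (1 - c) *: kx'))) (kz - kx')
    + ip y' (w' - kz) - ip yy (w' - kx') =
  theta / 2 * (`|w - kz| ^+ 2 - `|w' - kz| ^+ 2 - `|w - kx'| ^+ 2)
  + c * theta / 2 * (`|kx' - kx| ^+ 2 + `|kx' - kz| ^+ 2 - `|kx - kz| ^+ 2)
  + (ip (y' - yy) (w' - kx') + theta / 2 * `|w' - kx'| ^+ 2).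
Proof.
move=> ip_norm y'.
rewrite -!ip_norm /y' !innerE (innerC ip kz w) (innerC ip kz w').
rewrite (innerC ip kz kx') (innerC ip kz kx) (innerC ip kx' w).
rewrite (innerC ip kx' w') (innerC ip kx' kx); by field.
Qed.

(** For positive [kappa] the left side equals
    [t ^+ 2 / (2 * kappa) * (`|y - yy| ^+ 2 - `|y' - yy| ^+ 2)], whose weight
    grows with [t]. Subtracting [D ^+ 2] makes the distances nonpositive, so
    that lowering the weight of the first one from [t ^+ 2] to
    [(t - 1) ^+ 2] only increases the bound, and the result telescopes. For
    [kappa = 0] both sides vanish, because [y = yy]. *)
Lemma dual_step (V : normedVectType R) (ip : {inner V}) (kappa D : R) (t : nat)
    (y yy r y' : V) : induces_norm ip -> (0 < t)%N -> 0 <= kappa ->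
  (kappa = 0 -> D = 0) -> `|y - yy| <= D ->
  y' = y - (kappa / t%:R) *: r ->
  t%:R * (ip (y' - yy) r + kappa / t%:R / 2 * `|r| ^+ 2) <=
    (t%:R - 1) ^+ 2 / (2 * kappa) * (`|y - yy| ^+ 2 - D ^+ 2)
    - t%:R ^+ 2 / (2 * kappa) * (`|y' - yy| ^+ 2 - D ^+ 2).
Proof.
move=> ip_norm t0; rewrite le0r => /predU1P[-> kD yD y'E|k0 _ yD y'E].
  have D0 := kD erefl; move: yD; rewrite D0 normr_le0 subr_eq0 => /eqP yyy.
  rewrite y'E !mul0r scale0r subr0 yyy subrr inner0l mulr0 invr0 !mulr0.
  by rewrite !mul0r subrr addr0.
have tR : 1 <= t%:R :> R by rewrite ler1n.
have yD2 : `|y - yy| ^+ 2 <= D ^+ 2.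
  by rewrite ler_sqr ?nnegrE// (le_trans _ yD).
have -> : y' - yy = (y - yy) - (kappa / t%:R) *: r by rewrite y'E addrAC.
move: yD2; move: (y - yy) => v vD2.
rewrite -scaleNr (normD_sqr ip_norm v) !innerE normrZ exprMn real_normK ?num_real//.
rewrite (ip_norm r) -subr_ge0.
set n := `|r| ^+ 2; set m := t%:R in tR *.
rewrite (_ : _ - _ = (2 * m - 1) / (2 * kappa) * (D ^+ 2 - `|v| ^+ 2)); last first.
  by field; rewrite !gt_eqF//; lra.
by rewrite mulr_ge0 ?subr_ge0// divr_ge0//; lra.
Qed.

(** The weights [t * (t - 1) / 2] solve the recursion attached to
    [2 / (t + 1)], so the potential [t * (t - 1) / 2 * Phi t + P t] is
    nonincreasing; its first term vanishes at [t = 1]. *)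
Lemma potential_descent (Phi A P : nat -> R) (N : nat) :
  (forall t, (1 <= t < N)%N ->
     Phi t.+1 <= (1 - 2 / (t%:R + 1)) * Phi t + 2 / (t%:R + 1) * A t) ->
  (forall t, (1 <= t < N)%N -> t%:R * A t <= P t - P t.+1) ->
  (0 < N)%N -> N%:R * (N%:R - 1) / 2 * Phi N + P N <= P 1%N.
Proof.
move=> PhiA AP; elim: N PhiA AP => // -[_ _ _ _|n IH PhiA AP _].
  by rewrite subrr mulr0 !mul0r add0r.
have {}IH : n.+1%:R * (n.+1%:R - 1) / 2 * Phi n.+1 + P n.+1 <= P 1%N.
  by apply: IH => // t /andP[t0 tn]; [apply: PhiA | apply: AP]; rewrite t0 ltnW.
have n0 : 0 < n.+1%:R :> R by rewrite ltr0n.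
have := PhiA n.+1 (ltnSn _); have := AP n.+1 (ltnSn _).
rewrite -[n.+2%:R]natr1; set m := n.+1%:R in n0 IH *.
move=> APn PhiAn; have k0 : 0 <= (m + 1) * m / 2 by nra.
have := ler_wpM2l k0 PhiAn.
have -> : (m + 1) * m / 2 * ((1 - 2 / (m + 1)) * Phi n.+1 + 2 / (m + 1) * A n.+1)
    = m * (m - 1) / 2 * Phi n.+1 + m * A n.+1 by field; lra.
rewrite addrK; lra.
Qed.

End Steps.

(** * Convergence of the method *)

Section Convergence.
Context {R : realType} {E V : normedVectType R}.
Context (ipE : {inner E}) (ipV : {inner V}).
Context (ipE_norm : induces_norm ipE) (ipV_norm : induces_norm ipV).
Context (X : set E) (X_convex : convex_set X).
Context (G : E -> R) (G_convex : convex_function X G).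
Context (gradG : E -> E) (G_grad : is_gradient_on ipE X G gradG).
Context (LG : R) (LG_gt0 : 0 < LG).
Context (G_smooth : forall x1 x2, X x1 -> X x2 ->
  G x2 - G x1 - ipE (gradG x1) (x2 - x1) <= LG / 2 * `|x2 - x1| ^+ 2).
Context (F : V -> R) (F_convex : convex_function [set: V] F).
Context (K : {linear E -> V}) (K_bounded : bounded_near K (nbhs (0 : E))).
Context (chi : bool) (N : nat) (kappa : R) (kappa_ge0 : 0 <= kappa).
Context (x xmd xag : nat -> E) (w wag y yag : nat -> V).

(* [kappa] stands for [rho * N], the constant value of [t * theta t]. *)
Let c : R := chi%:R.
Let M : R := opnorm K.
Let alpha (t : nat) : R := 2 / (t%:R + 1).
Let theta (t : nat) : R := kappa / t%:R.
Let eta (t : nat) : R := (2 * LG + c * kappa * M ^+ 2) / t%:R.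

Context (run : is_aadmm ipE ipV X F idfun K 0 gradG chi
  alpha theta theta theta eta N x xmd xag w wag y yag).

Let alpha01 t : (0 < t)%N -> 0 <= alpha t <= 1.
Proof.
move=> t0; have tR : 1 <= t%:R :> R by rewrite ler1n.
have t1 : 0 < t%:R + 1 :> R by lra.
apply/andP; split; first by rewrite divr_ge0// ltW.
by rewrite ler_pdivrMr//; lra.
Qed.

Lemma iterates_in t : (0 < t <= N)%N -> X (x t) /\ X (xag t).
Proof.
elim: t => // -[_ _|t IH /andP[_ tN]].
  by rewrite (aadmm_xag1 run); have := aadmm_x1 run.
have [_ Xag] := IH (ltnW tN).
have [Xx _] := aadmm_x run (t := t.+1) tN.
split=> //; rewrite (aadmm_xag run (t := t.+1) tN).
by apply: convex_setP => //; exact: alpha01.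
Qed.

Lemma multiplier_subgradient t : (0 < t < N)%N ->
  is_subgradient ipV F (w t.+1) (y t.+1).
Proof.
move=> tN; rewrite (aadmm_y run tN) subr0; apply: prox_subgradient => //.
have := aadmm_w run tN; congr is_argmin.
by apply/funext => z; rewrite subr0.
Qed.

Lemma multiplier_dom t : dom_fconj ipV F 0 -> (0 < t <= N)%N ->
  dom_fconj ipV F (y t).
Proof.
move=> Y0; case: t => // -[_|t tN]; first by rewrite (aadmm_y1 run).
exact: subgradient_dom_fconj (multiplier_subgradient (t := t.+1) tN).
Qed.

(** Multiplication by [t] makes the weights of the proximal terms constant. The
    summand [2 * LG] of the step parameter pays for the smoothness error,
    since [t * alpha t / 2 <= 1]; the summand [kappa * M ^+ 2] leaves the last
    term, which pays for linearizing the penalty. *)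
Lemma x_update_bound t z : (0 < t < N)%N -> X z ->
  t%:R * (ipE (gradG (xmd t)) (x t.+1 - z)
          + LG * alpha t / 2 * `|x t.+1 - x t| ^+ 2) <=
    t%:R * ipV (y t - theta t *: (w t - (c *: K (x t) + (1 - c) *: K (x t.+1))))
               (K z - K (x t.+1))
    + (2 * LG + c * kappa * M ^+ 2) / 2
      * (`|x t - z| ^+ 2 - `|x t.+1 - z| ^+ 2)
    - c * kappa * M ^+ 2 / 2 * `|x t.+1 - x t| ^+ 2.
Proof.
move=> tN Xz; have /andP[t0 _] := tN.
have tR : 1 <= t%:R :> R by rewrite ler1n.
have : is_argmin X (fun z => ipE (gradG (xmd t)) z
    - c * theta t * ipV (w t - K (x t)) (K z)
    + (1 - c) * theta t / 2 * `|w t - K z| ^+ 2 + ipV (y t) (K z)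
    + eta t / 2 * `|z - x t| ^+ 2) (x t.+1).
  have := aadmm_x run tN; congr is_argmin.
  by apply/funext => u; rewrite !subr0.
move=> /(x_step_inequality ipE_norm ipV_norm X_convex) /(_ Xz).
have := four_point ipE_norm (x t.+1) (x t) z (x t.+1).
rewrite subrr normr0 expr0n /= (distrC (x t) (x t.+1)).
set p := ipE (gradG _) _; set q := ipV _ _; set s := ipE _ (z - _) => sE pq.
have pq' := ler_wpM2l (ler0n R t) pq; rewrite mulrDr mulrA in pq'.
have tL : t%:R * (LG * alpha t / 2) <= LG.
  have -> : t%:R * (LG * alpha t / 2) = LG * (t%:R / (t%:R + 1)).
    by rewrite /alpha; field; lra.
  by rewrite ler_piMr ?ltW// ltr_pdivrMr; lra.
have teta : t%:R * eta t = 2 * LG + c * kappa * M ^+ 2.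
  by rewrite /eta mulrC divfK// gt_eqF//; lra.
have n0 : 0 <= `|x t.+1 - x t| ^+ 2 by rewrite exprn_ge0.
have := ler_wpM2r n0 tL.
rewrite teta in pq'.
have : (2 * LG + c * kappa * M ^+ 2) * (2 * s) =
  (2 * LG + c * kappa * M ^+ 2)
  * (`|x t - z| ^+ 2 - `|x t.+1 - z| ^+ 2 - `|x t.+1 - x t| ^+ 2).
  by rewrite sE; ring.
lra.
Qed.

(** The distances of [w] enter [P] with a plus sign and, when [c = 1], those of
    [K x] with a minus sign: at time 1 they cancel as [w 1 = K (x 1)], and at
    time [N] the remaining negative term is dominated by the distance of [x]
    thanks to the operator norm. *)
Lemma gap_bound (D : R) (z : E) (yy : V) : (0 < N)%N -> X z ->
  (kappa = 0 -> D = 0) ->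
  (forall t, (0 < t <= N)%N -> `|y t - yy| <= D) ->
  N%:R * (N%:R - 1) / 2 *
    (G (xag N) - G z + (F (wag N) - F (K z)) - ipV yy (wag N - K (xag N))) <=
  (1 - c) * kappa / 2 * `|K (x 1%N) - K z| ^+ 2
  + (2 * LG + c * kappa * M ^+ 2) / 2 * `|x 1%N - z| ^+ 2
  + (N%:R - 1) ^+ 2 / (2 * kappa) * D ^+ 2.
Proof.
move=> N0 Xz kD yD.
pose Phi t := G (xag t) - G z + (F (wag t) - F (K z))
  - ipV yy (wag t - K (xag t)).
pose A t := ipE (gradG (xmd t)) (x t.+1 - z)
  + LG * alpha t / 2 * `|x t.+1 - x t| ^+ 2
  + ipV (y t.+1) (w t.+1 - K z) - ipV yy (w t.+1 - K (x t.+1)).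
pose P t := kappa / 2 * (`|w t - K z| ^+ 2 - c * `|K (x t) - K z| ^+ 2)
  + (2 * LG + c * kappa * M ^+ 2) / 2 * `|x t - z| ^+ 2
  + (t%:R - 1) ^+ 2 / (2 * kappa) * (`|y t - yy| ^+ 2 - D ^+ 2).
have step t : (0 < t < N)%N ->
    Phi t.+1 <= (1 - 2 / (t%:R + 1)) * Phi t + 2 / (t%:R + 1) * A t.
  move=> tN; have /andP[t0 tN'] := tN.
  rewrite -/(alpha t) /Phi /A.
  have [Xx Xxag] : X (x t) /\ X (xag t) by apply: iterates_in; rewrite t0 ltnW.
  have [Xx' _] : X (x t.+1) /\ X (xag t.+1) by exact: iterates_in.
  have a01 := alpha01 t0; have /andP[a0 a1] := a01.
  have := accelerated_step X_convex G_convex G_grad G_smooth Xxag Xx Xx' Xz a01.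
  rewrite -(aadmm_xag run tN) -(aadmm_xmd run tN).
  have := convex_functionP (x := wag t) (y := w t.+1) F_convex I I a01.
  rewrite -(aadmm_wag run tN).
  have := ler_wpM2l a0 (multiplier_subgradient tN (K z)).
  have -> : K (xag t.+1) = (1 - alpha t) *: K (xag t) + alpha t *: K (x t.+1).
    by rewrite (aadmm_xag run tN) linearD !linearZ.
  have -> : ipV yy (wag t.+1 - ((1 - alpha t) *: K (xag t)
      + alpha t *: K (x t.+1))) = (1 - alpha t) * ipV yy (wag t - K (xag t))
      + alpha t * ipV yy (w t.+1 - K (x t.+1)).
    by rewrite (aadmm_wag run tN) !innerE; ring.
  have -> : ipV (y t.+1) (K z - w t.+1) = - ipV (y t.+1) (w t.+1 - K z).
    by rewrite -innerNr opprB.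
  lra.
have descent t : (0 < t < N)%N -> t%:R * A t <= P t - P t.+1.
  move=> tN; have /andP[t0 tN'] := tN.
  have tR : 1 <= t%:R :> R by rewrite ler1n.
  have y'E : y t.+1 = y t - theta t *: (w t.+1 - K (x t.+1)).
    by rewrite (aadmm_y run tN) subr0.
  have ty : `|y t - yy| <= D by apply: yD; rewrite t0 ltnW.
  have := dual_step ipV_norm t0 kappa_ge0 kD ty y'E.
  have := primal_step (y t) yy (w t) (w t.+1) (K (x t)) (K (x t.+1)) (K z) c
    (theta t) ipV_norm.
  rewrite /= -y'E -/(theta t) => primal dual.
  have := x_update_bound tN Xz.
  have tth : t%:R * theta t = kappa.
    by rewrite /theta mulrC divfK// gt_eqF//; lra.
  have Kx : `|K (x t.+1) - K (x t)| ^+ 2 <= M ^+ 2 * `|x t.+1 - x t| ^+ 2.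
    rewrite -exprMn ler_sqr ?nnegrE ?mulr_ge0 ?opnorm_ge0//.
    by rewrite -linearB; exact: le_opnorm.
  have ck : 0 <= c * kappa / 2 by rewrite divr_ge0// mulr_ge0// ler0n.
  have := ler_wpM2l ck Kx.
  have w0 : 0 <= kappa / 2 * `|w t - K (x t.+1)| ^+ 2.
    by rewrite mulr_ge0 ?exprn_ge0// divr_ge0.
  have split3 (a1 a2 a3 : R) :
      t%:R * (theta t / 2 * a1 + c * theta t / 2 * a2 + a3) =
      kappa / 2 * a1 + c * kappa / 2 * a2 + t%:R * a3 by rewrite -tth; field.
  have := congr1 ( *%R t%:R) primal; rewrite split3.
  rewrite /A /P -[t.+1%:R]natr1 addrK; lra.
have := potential_descent step descent N0.
rewrite -/(Phi N) {1 2}/P subrr expr0n /= !mul0r addr0.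
have -> : w 1%N = K (x 1%N) by have := aadmm_w1 run; rewrite addr0.
have KM : c * kappa / 2 * `|K (x N) - K z| ^+ 2 <=
    c * kappa / 2 * (M ^+ 2 * `|x N - z| ^+ 2).
  apply: ler_wpM2l; first by rewrite divr_ge0// mulr_ge0// ler0n.
  rewrite -exprMn ler_sqr ?nnegrE ?mulr_ge0 ?opnorm_ge0//.
  by rewrite -linearB; exact: le_opnorm.
have wN : 0 <= kappa / 2 * `|w N - K z| ^+ 2.
  by rewrite mulr_ge0 ?exprn_ge0// divr_ge0.
have xN : 0 <= LG * `|x N - z| ^+ 2 by rewrite mulr_ge0 ?exprn_ge0// ltW.
have yN : 0 <= (N%:R - 1) ^+ 2 / (2 * kappa) * `|y N - yy| ^+ 2.
  by rewrite mulr_ge0 ?exprn_ge0// divr_ge0 ?sqr_ge0// mulr_ge0.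
rewrite /P; lra.
Qed.

(** If [K] is constant on [X], the coupling terms drop out of the [x]-update and
    the potential argument runs for [G] alone. *)
Lemma const_gap_bound (z : E) : (0 < N)%N -> X z -> kappa = 0 ->
  (forall u v, X u -> X v -> K u = K v) ->
  N%:R * (N%:R - 1) / 2 * (G (xag N) - G z) <= LG * `|x 1%N - z| ^+ 2.
Proof.
move=> N0 Xz k0 Kconst.
have step t : (0 < t < N)%N -> G (xag t.+1) - G z <=
    (1 - 2 / (t%:R + 1)) * (G (xag t) - G z) + 2 / (t%:R + 1) *
    (ipE (gradG (xmd t)) (x t.+1 - z)
     + LG * alpha t / 2 * `|x t.+1 - x t| ^+ 2).
  move=> tN; have /andP[t0 tN'] := tN.
  have [Xx Xxag] : X (x t) /\ X (xag t) by apply: iterates_in; rewrite t0 ltnW.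
  have [Xx' _] : X (x t.+1) /\ X (xag t.+1) by exact: iterates_in.
  rewrite (aadmm_xag run tN) (aadmm_xmd run tN).
  exact: (accelerated_step X_convex G_convex G_grad G_smooth Xxag Xx Xx' Xz
    (alpha01 t0)).
have descent t : (0 < t < N)%N -> t%:R *
    (ipE (gradG (xmd t)) (x t.+1 - z)
     + LG * alpha t / 2 * `|x t.+1 - x t| ^+ 2) <=
    LG * `|x t - z| ^+ 2 - LG * `|x t.+1 - z| ^+ 2.
  move=> tN; have /andP[_ tN'] := tN.
  have [Xx' _] : X (x t.+1) /\ X (xag t.+1) by exact: iterates_in.
  have := x_update_bound tN Xz.
  rewrite (Kconst _ _ Xz Xx') subrr inner0r k0; lra.
have := potential_descent (Phi := fun t => G (xag t) - G z)
  (P := fun t => LG * `|x t - z| ^+ 2) step descent N0.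
have : 0 <= LG * `|x N - z| ^+ 2 by rewrite mulr_ge0 ?exprn_ge0// ltW.
by move=> + H; lra.
Qed.

End Convergence.

Theorem theorem2p7 (R : realType) (E V : normedVectType R)
  (ipE : {inner E}) (ipV : {inner V})
  (ipE_norm : induces_norm ipE) (ipV_norm : induces_norm ipV)
  (X : set E) (X_closed : closed X) (X_convex : convex_set X)
  (G : E -> R) (G_convex : convex_function X G)
  (G_lsc : lower_semicontinuous
             (fun x : E => if x \in X then (G x)%:E else +oo%E))
  (F : V -> R) (F_convex : convex_function [set: V] F)
  (F_lsc : lower_semicontinuous (EFin \o F))
  (K : {linear E -> V}) (K_bounded : bounded_near K (nbhs (0 : E)))
  (gradG : E -> E) (G_C1 : C1_on ipE X G gradG)
  (LG : R) (LG_gt0 : 0 < LG)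
  (G_smooth : forall x1 x2, X x1 -> X x2 ->
     G x2 - G x1 - ipE (gradG x1) (x2 - x1) <= LG / 2 * `|x2 - x1| ^+ 2)
  (ws : V) (xs : E) (ys : V)
  (opt : is_optimal X G F idfun K 0 ws xs)
  (saddle : is_saddle_point ipV X G F idfun K 0 ws xs ys)
  (X_compact : compact X) (Y_compact : compact (dom_fconj ipV F))
  (Y0 : dom_fconj ipV F 0) (* y_1 = 0 lies in Y; the bound fails without it *)
  (chi : bool) (N : nat) (N_gt1 : (1 < N)%N)
  (x xmd xag : nat -> E) (w wag y yag : nat -> V) :
  let DX := diam X in
  let DY := diam (dom_fconj ipV F) in
  let DXK := diam_under K X in
  let rho := DY / (chi%:R * opnorm K * DX + (1 - chi%:R) * DXK) in
  let alpha := fun t : nat => 2 / (t%:R + 1) in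
  let theta := fun t : nat => rho * N%:R / t%:R in
  let eta := fun t : nat =>
    (2 * LG + chi%:R * rho * N%:R * opnorm K ^+ 2) / t%:R in
  is_aadmm ipE ipV X F idfun K 0 gradG chi alpha theta theta theta eta N
    x xmd xag w wag y yag ->
  G (xag N) + F (K (xag N)) - (G xs + F ws)
    <= 2 * LG * DX ^+ 2 / (N%:R * (N%:R - 1))
       + 2 / (N%:R - 1)
         * (chi%:R * opnorm K * DX * DY + (1 - chi%:R) * DXK * DY).
Proof.
move=> DX DY DXK rho alpha theta eta.
pose n : R := N%:R; pose M := opnorm K.
pose D := chi%:R * M * DX + (1 - chi%:R) * DXK.
have rhoE : rho = DY / D by [].
have n2 : 2 <= n by rewrite /n ler_nat.
pose kappa := rho * n.
have -> : eta = fun t => (2 * LG + chi%:R * kappa * M ^+ 2) / t%:R.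
  by apply/funext => t; rewrite /eta /kappa /n /M; congr (_ / _); ring.
move=> run.
have [G_grad _] := G_C1.
have [Xxs + _] := opt => /subr0_eq /= wsE; rewrite wsE.
have N0 : (0 < N)%N by exact: ltnW.
have Xx1 := aadmm_x1 run.
have DX_ge : `|x 1%N - xs| <= DX by exact: le_diam.
have DX0 : 0 <= DX by rewrite (le_trans _ DX_ge).
have DXK_ge : `|K (x 1%N) - K xs| <= DXK by exact: le_diam_under.
have DXK0 : 0 <= DXK by rewrite (le_trans _ DXK_ge).
have DY0 : 0 <= DY by have := le_diam Y_compact Y0 Y0; rewrite subrr normr0.
have M0 : 0 <= M by exact: opnorm_ge0.
have D0 : 0 <= D.
  by rewrite addr_ge0// !mulr_ge0// /= ?ler0n// subr_ge0 lern1 leq_b1.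
have rho0 : 0 <= rho by rewrite rhoE divr_ge0.
have kappa0 : 0 <= kappa by rewrite mulr_ge0// ler0n.
suff gap : n * (n - 1) / 2 * (G (xag N) + F (K (xag N)) - (G xs + F (K xs))) <=
    LG * DX ^+ 2 + n * D * DY.
  have n_gt0 : 0 < n * (n - 1) / 2 by nra.
  rewrite -(ler_pM2l n_gt0) (le_trans gap)// le_eqVlt; apply/orP; left; apply/eqP.
  by rewrite /D /n /M; field; rewrite -/n; lra.
have X2 : `|x 1%N - xs| ^+ 2 <= DX ^+ 2 by rewrite ler_sqr ?nnegrE.
(* Here rho = 0, the inverse of 0 being 0. *)
have [Deq|Dneq] := eqVneq D 0.
  have kappa_eq0 : kappa = 0 by rewrite /kappa rhoE Deq invr0 mulr0 mul0r.
  have Kconst u v : X u -> X v -> K u = K v.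
    move=> Xu Xv; apply: subr0_eq; apply/normr0_eq0/le_anti.
    rewrite normr_ge0 andbT.
    have uvX : `|u - v| <= DX by exact: le_diam.
    have KuvX : `|K u - K v| <= DXK by exact: le_diam_under.
    have Kuv : `|K u - K v| <= M * `|u - v| by rewrite -linearB; exact: le_opnorm.
    rewrite -Deq /D; case: (chi); last by rewrite !mul0r subr0 mul1r add0r.
    by rewrite mul1r subrr mul0r addr0 (le_trans Kuv)// ler_wpM2l.
  have [_ XagN] : X (x N) /\ X (xag N).
    by apply: (iterates_in X_convex run); rewrite N0 leqnn.
  have := const_gap_bound ipE_norm ipV_norm X_convex G_convex G_grad LG_gt0
    G_smooth run N0 Xxs kappa_eq0 Kconst.
  rewrite (Kconst _ _ XagN Xxs) Deq mulr0 mul0r addr0 -/n => gap.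
  rewrite opprD addrACA subrr addr0 (le_trans gap)//.
  by rewrite ler_wpM2l ?(ltW LG_gt0).
have [yy yyP] := exists_subgradient ipV F_convex (K (xag N)).
have Yyy := subgradient_dom_fconj yyP.
have yD t : (0 < t <= N)%N -> `|y t - yy| <= DY.
  move=> tN; apply: le_diam => //.
  exact: (multiplier_dom ipV_norm F_convex run).
have kD : kappa = 0 -> DY = 0.
  move=> /eqP; rewrite /kappa rhoE !mulf_eq0 invr_eq0 (negPf Dneq) orbF.
  by move=> /orP[/eqP//|]; rewrite gt_eqF//; lra.
have := gap_bound ipE_norm ipV_norm X_convex G_convex G_grad LG_gt0
    G_smooth F_convex K_bounded kappa0 run N0 Xxs kD yD.
rewrite -/n -/M.
have := yyP (wag N).
set I := ipV yy (_ - _) => FI gap.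
have n1 : 0 <= n * (n - 1) / 2 by nra.
have FIn := ler_wpM2l n1 FI.
have kappaD : kappa * D = n * DY.
  by rewrite /kappa rhoE mulrAC divfK// mulrC.
have primal : (1 - chi%:R) * kappa / 2 * `|K (x 1%N) - K xs| ^+ 2
    + chi%:R * kappa * M ^+ 2 / 2 * `|x 1%N - xs| ^+ 2 <= n * D * DY / 2.
  have -> : n * D * DY / 2 = kappa / 2 * D ^+ 2.
    by rewrite [n * D * DY]mulrAC -kappaD; ring.
  have k2 : 0 <= kappa / 2 by rewrite divr_ge0.
  have K2 : `|K (x 1%N) - K xs| ^+ 2 <= DXK ^+ 2 by rewrite ler_sqr ?nnegrE.
  have := ler_wpM2l k2 K2.
  have := ler_wpM2l (mulr_ge0 k2 (sqr_ge0 M)) X2.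
  by rewrite /D; case: (chi) => /=; lra.
have dual : (n - 1) ^+ 2 / (2 * kappa) * DY ^+ 2 <= n * D * DY / 2.
  (* The left side is 0 when kappa = 0, again because the inverse of 0 is 0. *)
  have [->|k0] := eqVneq kappa 0.
    by rewrite mulr0 invr0 mulr0 mul0r divr_ge0// !mulr_ge0//; lra.
  have kpos : 0 < kappa by rewrite lt_neqAle eq_sym k0.
  have DYE : DY = kappa * D / n by rewrite kappaD mulrC mulKf// gt_eqF//; lra.
  have -> : n * D * DY / 2 = n ^+ 2 / (2 * kappa) * DY ^+ 2.
    by rewrite DYE; field; rewrite k0 gt_eqF//; lra.
  apply: ler_wpM2r; first exact: sqr_ge0.
  apply: ler_wpM2r; first by rewrite invr_ge0 mulr_ge0.
  by rewrite ler_sqr ?nnegrE; lra.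
have := ler_wpM2l (ltW LG_gt0) X2.
lra.
Qed.
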